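(* For all positive integers $n$ and $k$, we have $$\frac{T_{2n+1}(\boldsymbol{x}^k)}{T_1^{2n+1}(\boldsymbol{x}^k)}=\sum_{j=0}^n(-1)^jA_{2j+1}\binom{2n+1}{2j+1}\frac{T_{2n-2j}(\boldsymbol{x}^k)}{T_1^{2n-2j}(\boldsymbol{x}^k)}$$ as rational functions in $\boldsymbol{x}^k=(x_1,\dots,x_k)$, where $T_1^m(\boldsymbol{x}^k)$ denotes the $m$th power of $T_1(\boldsymbol{x}^k)$, and the polynomials $T_m$ and numbers $A_m$ are defined in the context.
   Context: For $N\ge 1$ let $$P_N(\boldsymbol{x}^k)=\sum_{\emptyset\ne S\subseteq\{1,\dots,k\}}(-1)^{|S|-1}\Big(\sum_{j\in S}x_j\Big)^N.$$ The symmetric polynomial $T_m(\boldsymbol{x}^k)$, $m\ge0$, is defined by $$P_{m+k}(\boldsymbol{x}^k)=(-1)^{k+1}\frac{(m+k)!}{m!}\,x_1x_2\cdots x_k\;T_m(\boldsymbol{x}^k),$$ with $T_0=1$; for example $T_1(\boldsymbol{x}^k)=\frac12(x_1+\cdots+x_k)$. The tangent/zig-zag numbers $A_j$ (counting up/down permutations) are defined by $$\sec x+\tan x=\sum_{j\ge0}A_j\frac{x^j}{j!}.$$ *)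

(* Defs.v *)
From HB Require Import structures.
From mathcomp Require Import all_boot all_order all_algebra.
From mathcomp Require Import mpoly.

Set Implicit Arguments.
Unset Strict Implicit.
Unset Printing Implicit Defensive.

Import GRing.Theory Num.Theory.
Local Open Scope ring_scope.

Definition Ppoly (k N : nat) : {mpoly rat[k]} :=
  \sum_(S : {set 'I_k} | S != set0)
     (-1) ^+ (#|S| - 1) * (\sum_(j in S) 'X_j) ^+ N.

Definition Tpoly_eqn (k m : nat) (t : {mpoly rat[k]}) : bool :=
  Ppoly k (m + k) ==
    ((-1) ^+ (k + 1) * ((m + k)`!%:R / m`!%:R)) *: ((\prod_(i < k) 'X_i) * t).

Lemma sum_supersets (k : nat) (A : {set 'I_k}) : A != set0 ->
  \sum_(S : {set 'I_k} | A \subset S) (-1) ^+ (#|S| - 1) =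
    (if A == setT then (-1) ^+ (k - 1) else 0) :> {mpoly rat[k]}.
Proof.
move=> A0; case: eqP => [->|/eqP AT].
  by under eq_bigl do rewrite subTset; rewrite big_pred1_eq cardsT card_ord.
have [i iA] : exists i, i \notin A.
  apply/existsP; apply: contraR AT; rewrite negb_exists => /forallP h.
  by apply/eqP/setP => i; rewrite inE; move: (h i); rewrite negbK => ->.
rewrite (bigID (fun S : {set 'I_k} => i \in S)) /=.
rewrite (reindex_onto (fun S => i |: S) (fun S => S :\ i)) /=; last first.
  by move=> S /andP[_ iS]; rewrite setD1K.
have eqS (S : {set 'I_k}) :
  [&& A \subset i |: S, i \in i |: S & (i |: S) :\ i == S]
  = (A \subset S) && (i \notin S).
  have [iS|iS] := boolP (i \in S).
    rewrite !andbF andbA; apply/negP => /andP[_ /eqP/setP/(_ i)].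
    by rewrite !inE eqxx iS.
  rewrite setU11 (setU1K iS) eqxx !andbT.
  apply/idP/idP => /subsetP h; apply/subsetP => j jA.
    by have := h j jA; rewrite !inE => /predU1P[ji|//]; rewrite -ji jA in iA.
  by rewrite inE h ?orbT.
under eq_bigl do rewrite -andbA eqS.
rewrite -big_split /= big1 // => S /andP[AS iS].
have S0 : (0 < #|S|)%N.
  by rewrite card_gt0; apply: contraNneq A0 => S0; rewrite -subset0 -S0.
by rewrite cardsU1 iS /= -addnBA // exprS mulN1r addNr.
Qed.

Lemma Ppoly_surj (k N : nat) : (0 < N)%N -> Ppoly k N =
  (-1) ^+ (k - 1) *
  \sum_(f : {ffun 'I_N -> 'I_k} | f @: setT == setT) \prod_i 'X_(f i).
Proof.
move=> N0; rewrite /Ppoly.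
have distr (S : {set 'I_k}) : (\sum_(j in S) 'X_j) ^+ N =
   \sum_(f : {ffun 'I_N -> 'I_k} | f @: setT \subset S) \prod_i 'X_(f i)
   :> {mpoly rat[k]}.
  rewrite -[in LHS](card_ord N) -prodr_const bigA_distr_big.
  apply: eq_bigl => f; apply/ffun_onP/subsetP => [h x /imsetP[i _ ->] //|h i].
  exact/h/imset_f.
have im0 (f : {ffun 'I_N -> 'I_k}) : f @: setT != set0.
  by apply/set0Pn; exists (f (Ordinal N0)); apply: imset_f.
under eq_bigr do rewrite distr mulr_sumr.
rewrite (exchange_big_dep xpredT) //= mulr_sumr [RHS]big_mkcond /=.
apply: eq_bigr => f _; rewrite -mulr_suml.
rewrite (eq_bigl (fun S : {set 'I_k} => f @: setT \subset S)); last first.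
  move=> S; case: (boolP (_ \subset S)) => [h|]; rewrite ?andbF // andbT.
  by apply: contraNneq (im0 f) => S0; rewrite -subset0 -S0.
by rewrite (sum_supersets (im0 f)); case: ifP => _; rewrite ?mul0r.
Qed.

Lemma prodX_surj (k N : nat) (f : {ffun 'I_N -> 'I_k}) : f @: setT == setT ->
  exists q : {mpoly rat[k]}, \prod_i 'X_(f i) = (\prod_(i < k) 'X_i) * q.
Proof.
move=> /eqP fT.
have fP j : exists i, f i == j.
  by have /imsetP[i _ ->] : j \in f @: setT; rewrite ?fT ?inE //; exists i.
pose g j := xchoose (fP j).
have gK : cancel g f by move=> j; apply/eqP; exact: (xchooseP (fP j)).
exists (\prod_(i | i \notin g @: setT) 'X_(f i)).
rewrite (bigID (fun i => i \in g @: setT)) /=; congr (_ * _).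
rewrite big_imset /=; last by move=> x y _ _; apply: can_inj gK x y.
by apply: eq_big => [i|i _]; rewrite ?inE // gK.
Qed.

Lemma Tpoly_exists (k m : nat) : exists t, @Tpoly_eqn k m t.
Proof.
case: k => [|k].
  exists 0; rewrite /Tpoly_eqn mulr0 scaler0 /Ppoly big1 // => S.
  by case/set0Pn => -[].
have c0 : (m + k.+1)`!%:R / m`!%:R != 0 :> rat.
  by rewrite mulf_neq0 ?invr_eq0 ?pnatr_eq0 -?lt0n ?fact_gt0.
have [q hq] : exists q : {mpoly rat[k.+1]},
    \sum_(f : {ffun 'I_(m + k.+1) -> 'I_k.+1} | f @: setT == setT)
      \prod_i 'X_(f i) = (\prod_(i < k.+1) 'X_i) * q.
  apply: (big_ind (fun p => exists q, p = (\prod_(i < k.+1) 'X_i) * q)) =>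
    [|x y [p ->] [q ->]|f]; last exact: prodX_surj.
    by exists 0; rewrite mulr0.
  by exists (p + q); rewrite mulrDr.
exists (((m + k.+1)`!%:R / m`!%:R)^-1 *: q).
rewrite /Tpoly_eqn Ppoly_surj ?addn_gt0 ?orbT // hq -scalerAr scalerA.
rewrite mulfK // addn1 subn1 /= !exprS !mulN1r opprK.
by rewrite -[_ ^+ k]signr_odd -[in X in _ == X]signr_odd scaler_sign mulr_sign.
Qed.

(* The factor x_1 ... x_k is nonzero, so the equation has exactly one
   solution (Tpoly_unique); [xchoose] picks it. *)
Definition Tpoly (k m : nat) : {mpoly rat[k]} := xchoose (Tpoly_exists k m).

Lemma TpolyP (k m : nat) :
  Ppoly k (m + k) =
    ((-1) ^+ (k + 1) * ((m + k)`!%:R / m`!%:R)) *: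
      ((\prod_(i < k) 'X_i) * Tpoly k m).
Proof. exact/eqP/(xchooseP (Tpoly_exists k m)). Qed.

Lemma Tpoly_unique (k m : nat) (t : {mpoly rat[k]}) :
  Tpoly_eqn m t -> t = Tpoly k m.
Proof.
rewrite /Tpoly_eqn TpolyP => /eqP/scalerI e.
have X0 : \prod_(i < k) 'X_i != 0 :> {mpoly rat[k]}.
  by apply/prodf_neq0 => i _; rewrite -msupp_eq0 msuppX.
apply: (mulfI X0); rewrite e // !mulf_neq0 ?signr_eq0 //.
  by rewrite pnatr_eq0 -lt0n fact_gt0.
by rewrite invr_eq0 pnatr_eq0 -lt0n fact_gt0.
Qed.

Lemma Tpoly0 (k : nat) : (0 < k)%N -> Tpoly k 0 = 1.
Proof.
case: k => // k _; apply/esym/Tpoly_unique; rewrite /Tpoly_eqn mulr1 add0n.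
rewrite Ppoly_surj // fact0 divr1 addn1 subn1 /= !exprS !mulN1r opprK -scalerA.
rewrite -[_ ^+ k]signr_odd -[in X in _ == X]signr_odd scaler_sign mulr_sign.
rewrite (eq_bigl (fun f : {ffun 'I_k.+1 -> 'I_k.+1} => injectiveb f)); last first.
  move=> f; apply/idP/idP => [/eqP fT|/injectiveP finj].
    apply/injectiveP.
    have /imset_injP h : #|f @: setT| == #|[set: 'I_k.+1]| by rewrite fT.
    by move=> x y; apply: h; rewrite inE.
  by rewrite eqEcard subsetT card_imset ?leqnn.
suff -> : \sum_(f : {ffun 'I_k.+1 -> 'I_k.+1} | injectiveb f)
    \prod_(i < k.+1) 'X_(f i) =
    (k.+1)`!%:R *: \prod_(i < k.+1) 'X_i :> {mpoly rat[k.+1]} by [].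
rewrite (eq_bigr (fun=> \prod_(i < k.+1) 'X_i)); last first.
  by move=> f /injectiveP finj; rewrite [RHS](reindex_inj finj).
rewrite sumr_const scaler_nat; congr (_ *+ _).
have := card_inj_ffuns 'I_k.+1 'I_k.+1.
by rewrite !card_ord ffactnn => <-; rewrite cardsE.
Qed.

(* Formal power series over rat, given by their coefficient sequences. *)
Definition fps_mul (f g : nat -> rat) (n : nat) : rat :=
  \sum_(i < n.+1) f i * g (n - i)%N.

(* The first n coefficients of 1 / f, for f 0 != 0. *)
Fixpoint fps_inv_seq (f : nat -> rat) (n : nat) : seq rat :=
  if n is m.+1 then
    let s := fps_inv_seq f m in
    rcons s (((m == 0%N)%:R - \sum_(i < m) s`_i * f (m - i)%N) / f 0%N)
  else [::].

Definition fps_inv (f : nat -> rat) (n : nat) : rat :=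
  (fps_inv_seq f n.+1)`_n.

Lemma size_fps_inv_seq f n : size (fps_inv_seq f n) = n.
Proof. by elim: n => //= n IHn; rewrite size_rcons IHn. Qed.

Lemma nth_fps_inv_seq f n i : (i < n)%N -> (fps_inv_seq f n)`_i = fps_inv f i.
Proof.
elim: n => // n IHn; rewrite ltnS leq_eqVlt => /predU1P[-> //|lt_in].
by rewrite /= nth_rcons size_fps_inv_seq lt_in IHn.
Qed.

Lemma fps_mulVr (f : nat -> rat) (n : nat) :
  f 0%N != 0 -> fps_mul (fps_inv f) f n = (n == 0%N)%:R.
Proof.
move=> f0; rewrite /fps_mul big_ord_recr /= subnn {2}/fps_inv /=.
rewrite nth_rcons size_fps_inv_seq ltnn eqxx divfK //.
under [X in _ + (_ - X)]eq_bigr do rewrite nth_fps_inv_seq //.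
by rewrite addrC subrK.
Qed.

Definition cos_fps (n : nat) : rat := (~~ odd n)%:R * (-1) ^+ n./2 / n`!%:R.
Definition sin_fps (n : nat) : rat := (odd n)%:R * (-1) ^+ n./2 / n`!%:R.
Definition sec_fps : nat -> rat := fps_inv cos_fps.
Definition tan_fps : nat -> rat := fps_mul sin_fps sec_fps.

(* A_j / j! is the coefficient of x^j in sec x + tan x. *)
Definition zigzag (j : nat) : rat := j`!%:R * (sec_fps j + tan_fps j).

(* Main.v *)
Require Import Defs.
From mathcomp Require Import all_boot all_order all_algebra.
From mathcomp Require Import mpoly ring zify.
Import GRing.Theory Num.Theory.
Local Open Scope ring_scope.

(** Exponential generating functions explain the identity: the T_m satisfy

      sum_m T_m u^m / m! = prod_i (exp (x_i u) - 1) / (x_i u),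

    and pulling exp (x_i u / 2) out of each factor leaves
    exp (s u) * prod_i sinh (x_i u / 2) / (x_i u / 2), with
    s = (x_1 + ... + x_k) / 2 = T_1.  The remaining product E(u) is even in u.
    So the odd part of the series is sinh (s u) E(u), the even part is
    cosh (s u) E(u), and the odd part is tanh (s u) times the even one.  The
    coefficients of tanh are those of tan with alternating signs, that is
    (-1)^j A_{2j+1}; comparing coefficients of u^(2n+1) and dividing by
    s^(2n+1) gives the theorem.

    The proof works on coefficients.  Up to the factor x_1 ... x_k, a sign
    and factorials, the coefficients of E(u) are the moments
    sum_S (-1)^|S| (x_S - s)^N over the subsets S of the variables, where x_S
    is the sum of the variables in S and N runs from k.  Replacing S by its complement negates
    x_S - s, so that half of these moments vanish
    ([subset_moment_half_sum]): this is the evenness of E.  The binomial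
    theorem moves the centre from s to 0 ([scaled_moment_shift]), where the
    moments are those that define T_m; this is the multiplication by
    exp (s u).  Finally [sum_zigzag_bin] is the relation tanh * cosh = sinh, and
    [even_binomial_transform] turns it into the recurrence for the odd terms of
    any sequence that is exp (s u) times an even series.

    Identities between the T_m are proved after multiplication by x_1 ... x_k,
    and this nonzero factor is cancelled in [Tpoly1] and [Tpoly_odd]: no
    divisibility has to be shown for the moments around s. *)

Set Implicit Arguments.
Unset Strict Implicit.

(** * Tangent and secant numbers *)

Lemma natr_fact_neq0 (m : nat) : m`!%:R != 0 :> rat.
Proof. by rewrite pnatr_eq0 -lt0n fact_gt0. Qed.

(** Truncating both series to polynomials of the same size [N] leaves the
    product unchanged below degree [N]; this transfers ring identities of
    polynomials to [fps_mul]. *)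
Lemma fps_mul_coef (f g : nat -> rat) (N i : nat) : (i < N)%N ->
  fps_mul f g i = ((\poly_(j < N) f j) * (\poly_(j < N) g j))`_i.
Proof.
move=> iN; rewrite coefM; apply: eq_bigr => -[j /= ji] _.
by rewrite !coef_poly (leq_trans ji iN) (leq_ltn_trans (leq_subr j i) iN).
Qed.

Lemma fps_mulA (f g h : nat -> rat) (n : nat) :
  fps_mul (fps_mul f g) h n = fps_mul f (fps_mul g h) n.
Proof.
set P := fun f : nat -> rat => \poly_(i < n.+1) f i.
have PE u i : (i < n.+1)%N -> (P u)`_i = u i by move=> lt_i; rewrite coef_poly lt_i.
transitivity ((P f * P g * P h)`_n).
  rewrite coefM; apply: eq_bigr => -[i lt_i] _ /=.
  by rewrite PE ?ltnS ?leq_subr // -fps_mul_coef.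
rewrite -mulrA coefM; apply: eq_bigr => -[i lt_i] _ /=.
by rewrite PE // [fps_mul g h _](@fps_mul_coef _ _ n.+1) // ltnS leq_subr.
Qed.

Lemma cos_fps_odd (n : nat) : odd n -> cos_fps n = 0.
Proof. by move=> on; rewrite /cos_fps on !mul0r. Qed.

Lemma cos_fps_double (n : nat) : cos_fps (2 * n) = (-1) ^+ n / (2 * n)`!%:R.
Proof. by rewrite /cos_fps mul2n odd_double doubleK mul1r. Qed.

Lemma sin_fps_odd (n : nat) :
  sin_fps (2 * n + 1) = (-1) ^+ n / (2 * n + 1)`!%:R.
Proof. by rewrite /sin_fps addn1 mul2n /= odd_double uphalf_double mul1r. Qed.

Lemma cos_fps0 : cos_fps 0 = 1.
Proof. by apply/eqP. Qed.

Lemma sec_fps_odd (n : nat) : odd n -> sec_fps n = 0.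
Proof.
elim/ltn_ind: n => n IHn on.
have : fps_mul sec_fps cos_fps n = 0.
  by rewrite fps_mulVr ?cos_fps0 ?oner_eq0 //; case: n on {IHn}.
rewrite /fps_mul big_ord_recr /= subnn cos_fps0 mulr1 big1 ?add0r //.
move=> [i lt_in] _ /=; have [oi|ei] := boolP (odd i).
  by rewrite IHn ?mul0r.
by rewrite cos_fps_odd ?mulr0 // oddB 1?ltnW // on (negbTE ei).
Qed.

Lemma tan_mul_cos (n : nat) : fps_mul tan_fps cos_fps n = sin_fps n.
Proof.
rewrite fps_mulA /fps_mul big_ord_recr /= subnn big1 => [|[i lt_in] _ /=].
  by rewrite [X in _ * X]fps_mulVr ?cos_fps0 ?oner_eq0 // mulr1 add0r.
rewrite [X in _ * X]fps_mulVr ?cos_fps0 ?oner_eq0 //.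
by rewrite subn_eq0 leqNgt lt_in mulr0.
Qed.

Lemma sum_even_odd (V : nmodType) (F : nat -> V) (n : nat) :
  \sum_(0 <= i < (2 * n)%N) F i =
  \sum_(0 <= j < n) F (2 * j)%N + \sum_(0 <= j < n) F (2 * j + 1)%N.
Proof.
elim: n => [|n IHn]; first by rewrite !big_nil addr0.
rewrite (_ : 2 * n.+1 = (2 * n).+2)%N; last by lia.
rewrite big_nat_recr //= big_nat_recr //= IHn.
rewrite [\sum_(0 <= j < n.+1) F (2 * j)%N]big_nat_recr //=.
rewrite [\sum_(0 <= j < n.+1) F (2 * j + 1)%N]big_nat_recr //= addn1.
by rewrite -addrA addrACA.
Qed.

Lemma sum_nat_widen (V : nmodType) (F : nat -> V) (m n : nat) : (m <= n)%N ->
  (forall i, (m <= i < n)%N -> F i = 0) ->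
  \sum_(0 <= i < m) F i = \sum_(0 <= i < n) F i.
Proof.
move=> le_mn F0; rewrite (big_cat_nat (leq0n m) le_mn) /=.
by rewrite [X in _ + X]big_nat [X in _ + X]big1 ?addr0.
Qed.

(** The coefficient of x^(2p+1) in tan x * cos x = sin x, multiplied by
    (-1)^p (2p+1)!; the signs then are those of tanh * cosh = sinh.  The upper
    bound [n] is free because the terms with j > p vanish, which lets the same
    range serve for all [p] in a double sum. *)
Lemma sum_zigzag_bin (n p : nat) : (p <= n)%N ->
  \sum_(0 <= j < n.+1)
    (-1) ^+ j * zigzag (2 * j + 1) * 'C(2 * p + 1, 2 * j + 1)%:R = 1.
Proof.
move=> le_pn; rewrite -(@sum_nat_widen _ _ p.+1) //; last first.
  by move=> j /andP[pj _]; rewrite bin_small ?mulr0 //; lia.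
have f0 := natr_fact_neq0.
have := tan_mul_cos (2 * p + 1); rewrite sin_fps_odd /fps_mul.
rewrite -(big_mkord xpredT (fun i => tan_fps i * cos_fps (2 * p + 1 - i))).
rewrite (_ : (2 * p + 1).+1 = 2 * p.+1)%N; last by lia.
rewrite sum_even_odd [X in X + _]big_nat [X in X + _]big1 ?add0r; last first.
  by move=> j /andP[_ jp]; rewrite cos_fps_odd ?mulr0 //; lia.
move/(congr1 (fun x => (-1) ^+ p * (2 * p + 1)`!%:R * x)).
rewrite mulrACA mulfV // mulr1 -expr2 sqrr_sign => tan_cos.
rewrite -[RHS]tan_cos mulr_sumr; apply: eq_big_nat => j /andP[_ jp].
rewrite (_ : 2 * p + 1 - (2 * j + 1) = 2 * (p - j))%N; last by lia.
rewrite /zigzag sec_fps_odd ?add0r; last by lia.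
rewrite cos_fps_double.
have -> : (2 * p + 1)`!%:R = 'C(2 * p + 1, 2 * j + 1)%:R *
   ((2 * j + 1)`!%:R * (2 * (p - j))`!%:R) :> rat.
  rewrite -!natrM -(@bin_fact (2 * p + 1) (2 * j + 1)); last by lia.
  by congr (_ * (_ * _`!))%:R; lia.
have -> : (-1) ^+ p = (-1) ^+ j * (-1) ^+ (p - j) :> rat.
  by rewrite -exprD subnKC.
have := sqrr_sign rat (p - j).
set u := (-1) ^+ (p - j) => u2; field: u2.
by rewrite f0.
Qed.

(** * Sequences with an even exponential generating function, shifted *)

(** Both sides count the pairs of disjoint subsets of sizes [a] and [b] of a
    set with [N] elements. *)
Lemma bin_mul_exchange (N a b : nat) :
  ('C(N, a) * 'C(N - a, b) = 'C(N, b) * 'C(N - b, a))%N.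
Proof.
have [le_ab|lt_ab] := leqP (a + b) N; last first.
  have z c d : (N < c + d)%N -> ('C(N, c) * 'C(N - c, d) = 0)%N.
    move=> h; have [cN|cN] := leqP c N; last by rewrite bin_small.
    by rewrite [X in (_ * X)%N]bin_small ?muln0 //; lia.
  by rewrite !z // addnC.
have e c d : (c + d <= N)%N ->
    ('C(N, c) * 'C(N - c, d) * (c`! * d`! * (N - (c + d))`!) = N`!)%N.
  move=> h; rewrite -(@bin_fact N c); last by lia.
  rewrite -(@bin_fact (N - c) d); last by lia.
  by rewrite subnDA; ring.
have g : (0 < a`! * b`! * (N - (a + b))`!)%N by rewrite !muln_gt0 !fact_gt0.
apply/eqP; rewrite -(eqn_pmul2r g) e //.
by rewrite [(a`! * _)%N]mulnC [(a + b)%N]addnC e // addnC.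
Qed.

(** If e and t are the coefficients of the exponential series e(u) and
    t(u) = exp (s u) e(u), and e(u) is even, then the odd part of t(u) is
    tanh (s u) times its even part.  The coefficients of each e_(2l) on
    both sides agree by [bin_mul_exchange] and [sum_zigzag_bin]. *)
Lemma even_binomial_transform (V : comAlgType rat) (s : V) (e t : nat -> V) :
    (forall m, t m = \sum_(0 <= i < m.+1) 'C(m, i)%:R * s ^+ (m - i) * e i) ->
    (forall i, odd i -> e i = 0) ->
  forall n, t (2 * n + 1)%N = \sum_(0 <= j < n.+1)
    ((-1) ^+ j * zigzag (2 * j + 1) * 'C(2 * n + 1, 2 * j + 1)%:R) *:
      (s ^+ (2 * j + 1) * t (2 * n - 2 * j)%N).
Proof.
move=> tE e0 n.
(* The binomials vanish for i > m, so the range 0 <= i < 2(n+1), which pairs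
   2l with 2l+1, serves for all m <= 2n+1. *)
have {}tE m : (m <= 2 * n + 1)%N ->
    t m = \sum_(0 <= l < n.+1) 'C(m, 2 * l)%:R * s ^+ (m - 2 * l) * e (2 * l)%N.
  move=> le_m; rewrite tE (@sum_nat_widen _ _ _ (2 * n.+1)); first last.
  - by move=> i /andP[lt_mi _]; rewrite bin_small // !mul0r.
  - by lia.
  rewrite sum_even_odd [X in _ + X]big1 ?addr0 // => j _.
  by rewrite e0 ?mulr0 //; lia.
rewrite tE //.
have {}tE j : t (2 * n - 2 * j)%N = \sum_(0 <= l < n.+1)
    'C(2 * n - 2 * j, 2 * l)%:R * s ^+ (2 * n - 2 * j - 2 * l) * e (2 * l)%N.
  by rewrite tE //; lia.
under [RHS]eq_bigr do rewrite tE mulr_sumr scaler_sumr.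
rewrite exchange_big_nat /=; apply: eq_big_nat => l /andP[_ le_l].
rewrite -[LHS]scale1r -[X in X *: _ = _](@sum_zigzag_bin n (n - l)) ?leq_subr //.
rewrite scaler_suml.
apply: eq_big_nat => j /andP[_ le_j].
have natE m (x : V) : m%:R * x = m%:R *: x by rewrite mulr_natl scaler_nat.
rewrite -!mulrA !natE -scalerAr !scalerA -!mulrA -!natrM.
have -> : (2 * (n - l) + 1 = 2 * n + 1 - 2 * l)%N by lia.
rewrite [('C(2 * n + 1 - 2 * l, _) * _)%N]mulnC bin_mul_exchange.
have -> : (2 * n - 2 * j = 2 * n + 1 - (2 * j + 1))%N by lia.
(* For j + l > n the truncated exponents of s disagree, but the binomial
   coefficient is zero. *)
have [le_jl|lt_nl] := leqP (j + l) n; last first.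
  by rewrite ['C(_ - _, _)]bin_small ?muln0 ?mulr0 ?scale0r //; lia.
by rewrite [s ^+ (2 * j + 1) * _]mulrA -exprD; congr (_ *: (_ ^+ _ * _)); lia.
Qed.

(** * Alternating moments of the subset sums *)

Definition subset_moment (k : nat) (a : {mpoly rat[k]}) (N : nat) :
    {mpoly rat[k]} :=
  \sum_(S : {set 'I_k}) (-1) ^+ #|S| * (\sum_(j in S) 'X_j - a) ^+ N.

Lemma subset_moment_shift (k : nat) (a b : {mpoly rat[k]}) (N : nat) :
  subset_moment a N = \sum_(0 <= i < N.+1)
    'C(N, i)%:R * (b - a) ^+ (N - i) * subset_moment b i.
Proof.
under [RHS]eq_bigr do rewrite mulr_sumr.
rewrite exchange_big; apply: eq_bigr => S _; rewrite big_mkord.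
set x := \sum_(j in S) 'X_j.
rewrite (_ : x - a = (b - a) + (x - b)); last by ring.
rewrite exprDn mulr_sumr; apply: eq_bigr => i _.
by rewrite -mulr_natl; ring.
Qed.

Lemma subset_moment0 (k N : nat) : (0 < N)%N ->
  subset_moment (0 : {mpoly rat[k]}) N = - Ppoly k N.
Proof.
move=> N0; rewrite /subset_moment (bigD1 set0) //= big_set0 subr0 expr0n.
rewrite eqn0Ngt N0 mulr0 add0r /Ppoly -sumrN; apply: eq_bigr => S S0.
have : (0 < #|S|)%N by rewrite card_gt0.
by case: #|S| => // c _; rewrite subr0 subn1 exprS mulN1r mulNr.
Qed.

Lemma Ppoly_small (k N : nat) : (0 < N < k)%N -> Ppoly k N = 0.
Proof.
move=> /andP[N0 Nk]; rewrite Ppoly_surj // big_pred0 ?mulr0 // => f.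
apply: contraTF Nk => /eqP fT; rewrite -leqNgt.
have := leq_imset_card f [set: 'I_N].
by rewrite fT !cardsT !card_ord.
Qed.

(** The k-th finite difference of a polynomial of degree N < k.  Around 0 it
    vanishes because no map from N points to k points is onto (N > 0), or
    because prod_i (1 - 1) = 0 (N = 0); the shift formula gives all centres. *)
Lemma subset_moment_small (k : nat) (a : {mpoly rat[k]}) (N : nat) :
  (N < k)%N -> subset_moment a N = 0.
Proof.
move=> Nk; rewrite (subset_moment_shift a 0) big_nat big1 // => i /andP[_ iN].
have [->|i0] := posnP i; last first.
  by rewrite subset_moment0 // Ppoly_small ?oppr0 ?mulr0 // i0 /=; lia.
suff -> : subset_moment (0 : {mpoly rat[k]}) 0 = 0 by rewrite mulr0.
transitivity (\prod_(i < k) (-1 + 1) : {mpoly rat[k]}).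
  rewrite bigA_distr /subset_moment; apply: eq_bigr => S _.
  rewrite expr0 mulr1 -prodr_const [RHS](bigID [pred i in S]) /=.
  rewrite [X in _ * X]big1 ?mulr1; last by move=> j /negbTE ->.
  by apply: eq_bigr => j ->.
by rewrite prodr_const card_ord addNr expr0n eqn0Ngt (leq_ltn_trans _ Nk).
Qed.

Definition half_sum (k : nat) : {mpoly rat[k]} := 2^-1 *: \sum_(j < k) 'X_j.

(** Complementing S multiplies its term by (-1)^(N + k). *)
Lemma subset_moment_half_sum (k N : nat) : odd (N + k) ->
  subset_moment (half_sum k) N = 0.
Proof.
move=> oNk; set M := subset_moment _ _.
suff MN : M = - M.
  have : 2 *: M = 0 by rewrite scaler_nat mulr2n {2}MN subrr.
  by move/eqP; rewrite scaler_eq0 pnatr_eq0 => /eqP.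
rewrite {1}/M /subset_moment (reindex_inj (can_inj (@setCK _))) /= -sumrN.
apply: eq_bigr => S _.
have -> : \sum_(j in ~: S) 'X_j - half_sum k = - (\sum_(j in S) 'X_j - half_sum k).
  have h2 : half_sum k + half_sum k = \sum_(j < k) 'X_j.
    by rewrite -scalerDl (_ : _ + _ = 1 :> rat) ?scale1r //; apply/eqP.
  apply/eqP; rewrite opprB subr_eq addrAC eq_sym subr_eq h2.
  rewrite [X in X == _](bigID [pred j in S]) /= addrC; apply/eqP; congr (_ + _).
  by apply: eq_bigl => j; rewrite inE.
rewrite [(- (_ - _)) ^+ _]exprNn mulrA -exprD -mulNr; congr (_ * _).
rewrite -signr_odd -[in RHS]signr_odd -signrN; congr (_ ^+ _).
have := cardsC S; rewrite card_ord => /(congr1 odd).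
by move: oNk; rewrite !oddD; do 4!case: (odd _).
Qed.

(** The normalisation that makes the moments around 0 equal to
    x_1 ... x_k T_m, see [scaled_moment0]. *)
Definition scaled_moment (k : nat) (a : {mpoly rat[k]}) (m : nat) :=
  ((-1) ^+ k * (m`!%:R / (m + k)`!%:R)) *: subset_moment a (m + k).

Lemma scaled_moment0 (k m : nat) : (0 < k)%N ->
  scaled_moment 0 m = (\prod_(i < k) 'X_i) * Tpoly k m.
Proof.
move=> k0; have f0 := natr_fact_neq0.
rewrite /scaled_moment subset_moment0 ?addn_gt0 ?k0 ?orbT // TpolyP.
rewrite -scaleNr scalerA -[RHS]scale1r; congr (_ *: _).
rewrite exprD expr1; have := sqrr_sign rat k.
by set u := (-1) ^+ k => u2; field: u2; rewrite !f0.
Qed.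

(** The moments of order below k vanish, so the shift formula in order m + k
    starts at i = k, and the factorials turn 'C(m + k, i + k) into 'C(m, i). *)
Lemma scaled_moment_shift (k : nat) (a b : {mpoly rat[k]}) (m : nat) :
  scaled_moment a m =
  \sum_(0 <= i < m.+1) 'C(m, i)%:R * (b - a) ^+ (m - i) * scaled_moment b i.
Proof.
have f0 := natr_fact_neq0.
rewrite /scaled_moment (subset_moment_shift a b).
rewrite (big_cat_nat (leq0n k)) /=; last by lia.
rewrite [X in X + _]big_nat [X in X + _]big1 ?add0r; last first.
  by move=> i /andP[_ ik]; rewrite subset_moment_small ?mulr0.
rewrite -[X in \sum_(X <= _ < _) _]add0n big_addn -addSn addnK.
rewrite scaler_sumr; apply: eq_big_nat => i /andP[_ im].
rewrite subnDr -scalerAr -!mulrA !mulr_natl -!scaler_nat !scalerA; congr (_ *: _).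
rewrite -![_^-1 *+ _]mulr_natl -(@bin_fact (m + k) (i + k)) -?(@bin_fact m i); try lia.
rewrite subnDr !natrM; field; rewrite !f0 !pnatr_eq0 -!lt0n !bin_gt0.
by rewrite leq_add2r.
Qed.

(** * The polynomials T_m *)

Lemma scaled_moment_odd (k m : nat) : odd m ->
  scaled_moment (half_sum k) m = 0.
Proof.
move=> om; rewrite /scaled_moment subset_moment_half_sum ?scaler0 //.
by rewrite -addnA addnn oddD odd_double addbF.
Qed.

Lemma prodX_neq0 (k : nat) : \prod_(i < k) 'X_i != 0 :> {mpoly rat[k]}.
Proof. by apply/prodf_neq0 => i _; rewrite -msupp_eq0 msuppX. Qed.

Lemma Tpoly_shift (k m : nat) : (0 < k)%N ->
  (\prod_(i < k) 'X_i) * Tpoly k m =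
  \sum_(0 <= i < m.+1)
    'C(m, i)%:R * half_sum k ^+ (m - i) * scaled_moment (half_sum k) i.
Proof.
by move=> k0; rewrite -scaled_moment0 // (scaled_moment_shift 0 (half_sum k)) subr0.
Qed.

Lemma Tpoly1 (k : nat) : (0 < k)%N -> Tpoly k 1 = half_sum k.
Proof.
move=> k0; apply: (mulfI (prodX_neq0 k)).
have := Tpoly_shift 0 k0; rewrite big_nat1 Tpoly0 // bin0 expr0 !mul1r mulr1 => e0.
rewrite Tpoly_shift // big_nat_recr //= big_nat1 -e0.
by rewrite scaled_moment_odd // mulr0 addr0 bin0 subn0 expr1 mul1r mulrC.
Qed.

Lemma half_sum_neq0 (k : nat) : (0 < k)%N -> half_sum k != 0.
Proof.
move=> k0; rewrite scaler_eq0 invr_eq0 pnatr_eq0 /=.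
apply/eqP => /(congr1 (meval (fun=> 1 : rat))); rewrite meval0 raddf_sum /=.
under eq_bigr do rewrite mevalXU.
by rewrite sumr_const card_ord => /eqP; rewrite pnatr_eq0 eqn0Ngt k0.
Qed.

Lemma Tpoly_odd (n k : nat) : (0 < k)%N ->
  Tpoly k (2 * n + 1) = \sum_(0 <= j < n.+1)
    ((-1) ^+ j * zigzag (2 * j + 1) * 'C(2 * n + 1, 2 * j + 1)%:R) *:
      (Tpoly k 1 ^+ (2 * j + 1) * Tpoly k (2 * n - 2 * j)).
Proof.
move=> k0; apply: (mulfI (prodX_neq0 k)).
have /= -> := even_binomial_transform (fun m => Tpoly_shift m k0)
  (@scaled_moment_odd k) n.
rewrite Tpoly1 // mulr_sumr; apply: eq_bigr => j _.
by rewrite -scalerAr; congr (_ *: _); rewrite mulrCA.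
Qed.

Unset Implicit Arguments.

Theorem theorem1p7 (n k : nat) (n_gt0 : (0 < n)%N) (k_gt0 : (0 < k)%N) :
  tofrac (Tpoly k (2 * n + 1)) / tofrac (Tpoly k 1) ^+ (2 * n + 1)
  = \sum_(0 <= j < n.+1)
      (-1) ^+ j * tofrac (zigzag (2 * j + 1))%:MP *
      'C(2 * n + 1, 2 * j + 1)%:R *
      (tofrac (Tpoly k (2 * n - 2 * j)) / tofrac (Tpoly k 1) ^+ (2 * n - 2 * j))
  :> {fraction {mpoly rat[k]}}.
Proof.
have s0 : tofrac (Tpoly k 1) != 0 by rewrite tofrac_eq0 Tpoly1 ?half_sum_neq0.
rewrite Tpoly_odd // rmorph_sum mulr_suml; apply: eq_big_nat => j /andP[_ le_jn].
have -> : (2 * n + 1 = (2 * j + 1) + (2 * n - 2 * j))%N by lia.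
rewrite [in X in _ / X]exprD invfM -mul_mpolyC !rmorphM !rmorphXn /=.
rewrite !rmorphN1 !rmorph_nat.
rewrite -[LHS]mulrA; congr (_ * _).
by rewrite mulrACA mulfV ?mul1r // expf_neq0.
Qed.
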